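(* Let $-\infty<a<b<\infty$, let $n,m$ be integers with $3\le m\le n-1$, let $f\in\mathcal C^n([a,b])$, and let $g\in L$ be any function with $g(E)\subseteq[a,b]$ and $f\circ g\in L$. If $f$ is $n$-convex and $n$ and $m$ are of different parity, then $$LR(f,g,a,b,A)\le (A(g)-a)\left(f[a,a]-f[a,b]\right)+\sum_{k=2}^{m-1}\frac{f^{(k)}(a)}{k!}A\left[(g-a\mathbf 1)^{k}\right]+\sum_{k=1}^{n-m}f[\underbrace{a,\dots,a}_{m\text{ times}};\underbrace{b,\dots,b}_{k\text{ times}}]\,A\left[(g-a\mathbf 1)^{m}(g-b\mathbf 1)^{k-1}\right].$$ The same inequality also holds when $f$ is $n$-concave and $n$ and $m$ are of equal parity. If $f$ is $n$-convex and $n$ and $m$ are of equal parity, or if $f$ is $n$-concave and $n$ and $m$ are of different parity, then the inequality holds with the sign reversed ($\ge$ in place of $\le$).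
   Context: $E$ is a non-empty set; $L$ is a vector space (under pointwise operations) of functions $E\to\mathbb R$ containing the constant function $\mathbf 1$ (with $\mathbf 1(t)=1$ for all $t\in E$). $A\colon L\to\mathbb R$ is a positive linear functional (linear, and $A(h)\ge 0$ whenever $h\in L$ and $h(t)\ge0$ for all $t\in E$) with $A(\mathbf 1)=1$. Products and powers of functions are pointwise, and $(g-b\mathbf 1)^0=\mathbf 1$. $$LR(f,g,a,b,A)=A(f\circ g)-\frac{b-A(g)}{b-a}f(a)-\frac{A(g)-a}{b-a}f(b).$$ Divided differences: for $f\in\mathcal C^n([a,b])$ and points $t_0\le t_1\le\dots\le t_k$ in $[a,b]$, $k\le n$, not necessarily distinct, $f[t_0,\dots,t_k]=f^{(k)}(t_0)/k!$ if $t_0=t_k$, and $f[t_0,\dots,t_k]=\dfrac{f[t_1,\dots,t_k]-f[t_0,\dots,t_{k-1}]}{t_k-t_0}$ otherwise. The value is taken to be independent of the order in which the points are listed; commas and semicolons both separate points. In particular $f[a,a]=f'(a)$. A function $f\colon[a,b]\to\mathbb R$ is $n$-convex if $f[t_0,\dots,t_n]\ge0$ for all choices of $n+1$ distinct points $t_0,\dots,t_n\in[a,b]$; it is $n$-concave if $-f$ is $n$-convex. *)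

(* Defs.v *)
From mathcomp Require Export all_boot all_order all_algebra.
From mathcomp Require Export all_classical all_reals all_analysis.
Export Order.TTheory GRing.Theory Num.Theory.
Export numFieldNormedType.Exports.

Set Implicit Arguments.
Unset Strict Implicit.
Unset Printing Implicit Defensive.

Local Open Scope classical_set_scope.
Local Open Scope ring_scope.

(* A real function on [a, b] is represented by a total function f : R -> R;
   every definition below depends only on the values of f on [a, b].  In
   particular derivatives are taken relative to [a, b], hence are one-sided
   at a and b. *)
Section OnInterval.
Context {R : realType}.
Variables a b : R.
Implicit Types (f : R -> R) (x : R) (n : nat).

(* difference quotients of f at x, along y -> x with y in [a, b] and y != x *)
Definition quotients_within f x : set_system R :=
  (f y - f x) / (y - x) @[y --> within `[a, b] x^'].

Definition derive_within f : R -> R := fun x => lim (quotients_within f x).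

Definition nderive_within n f : R -> R := iter n derive_within f.

Definition Cn_within n f : Prop :=
  (forall i x, (i < n)%N -> x \in `[a, b] ->
     cvg (quotients_within (nderive_within i f) x)) /\
  {within `[a, b], continuous (nderive_within n f)}.

(* f[t_i, ..., t_(i+k)] for a nondecreasing sequence of points t *)
Fixpoint divdiff_sorted f (t : nat -> R) (i k : nat) : R :=
  if k is k'.+1 then
    if t i == t (i + k)%N then nderive_within k f (t i) / k`!%:R
    else (divdiff_sorted f t i.+1 k' - divdiff_sorted f t i k')
         / (t (i + k)%N - t i)
  else f (t i).

(* The points are sorted first, so that the value does not depend on the order
   in which they are listed. *)
Definition divdiff f (s : seq R) : R :=
  divdiff_sorted f (nth 0 (sort <=%R s)) 0 (size s).-1.

Definition nconvex n f : Prop :=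
  forall t : n.+1.-tuple R, uniq t -> {in t, forall x, x \in `[a, b]} ->
    0 <= divdiff f t.

Definition nconcave n f : Prop := nconvex n (fun x => - f x).

End OnInterval.

(* A functional A : L -> R on a space of functions L is represented by a total
   A : (E -> R) -> R of which only the values on L are constrained. *)
Definition normalized_positive_functional {R : realType} {E : Type}
    (L : {pred E -> R}) (A : (E -> R) -> R) : Prop :=
  [/\ {in L &, forall h1 h2, forall c : R, A (c *: h1 + h2) = c * A h1 + A h2},
      {in L, forall h, (forall t, 0 <= h t) -> 0 <= A h}
    & A 1 = 1].

Definition LR {R : realType} {E : Type} (f : R -> R) (g : E -> R) (a b : R)
    (A : (E -> R) -> R) : R :=
  A (f \o g) - (b - A g) / (b - a) * f a - (A g - a) / (b - a) * f b.

(* Main.v *)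
Require Import Defs.
From mathcomp Require Import ring lra zify.

(* Let N be the Newton form of the Hermite interpolation polynomial of f with a
   as an m-fold and b as an (n-m)-fold node.  By generalized Rolle,
     f(x) - N(x) = f^(n)(z)/n! (x-a)^m (x-b)^(n-m)   for some z in [a,b],
   and n-convexity gives f^(n) >= 0, so f - N has the constant sign
   (-1)^(n-m) on [a,b].  LR minus the right-hand side is A((f - N) o g). *)

Set Implicit Arguments.
Unset Strict Implicit.
Unset Printing Implicit Defensive.

Local Open Scope classical_set_scope.
Local Open Scope ring_scope.

(** * Divided differences and Newton interpolation with repeated nodes *)

Section Newton.
Context {R : realType}.
Variables (a b : R) (f : R -> R).
Implicit Types (t : nat -> R) (i j k n : nat).

Lemma eq_divdiff_sorted t t' i k :
  (forall l, (i <= l <= i + k)%N -> t l = t' l) ->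
  divdiff_sorted a b f t i k = divdiff_sorted a b f t' i k.
Proof.
elim: k i => [|k IHk] i tt'; first by rewrite /= tt' ?addn0 ?leqnn.
rewrite /= !tt' ?leqnn ?leq_addr// (IHk i) ?(IHk i.+1)// => l /andP[il lk].
- by apply: tt'; rewrite (ltnW il) addnS -addSn.
- by apply: tt'; rewrite il addnS (leq_trans lk).
Qed.

Lemma divdiff_sorted_confluent t i k :
  {homo t : l r / (l <= r)%N >-> l <= r} -> t i = t (i + k)%N ->
  divdiff_sorted a b f t i k = nderive_within a b k f (t i) / k`!%:R.
Proof. by case: k => [|k] _ /= tik; rewrite ?divr1// tik eqxx. Qed.

(** Clearing the denominator makes the recursion uniform: if the two end nodes coincide, so do all
    nodes between them, and both divided differences on the right are the same derivative
    quotient. *)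
Lemma divdiff_sortedS t i k : {homo t : l r / (l <= r)%N >-> l <= r} ->
  (t (i + k.+1)%N - t i) * divdiff_sorted a b f t i k.+1 =
  divdiff_sorted a b f t i.+1 k - divdiff_sorted a b f t i k.
Proof.
move=> tle; have [tik|tik] := eqVneq (t i) (t (i + k.+1)%N); last first.
  by rewrite /= (negbTE tik) mulrC divfK// subr_eq0 eq_sym.
have tE l : (i <= l <= i + k.+1)%N -> t l = t i.
  move=> /andP[il lk]; apply/eqP; rewrite eq_le (tle _ _ il) andbT tik.
  exact: tle.
rewrite -tik subrr mul0r !divdiff_sorted_confluent ?tE ?subrr ?leqnn//.
all: by rewrite ?addSn ?addnS ?leqnn ?leq_addr ?leqnSn ?ltnS ?leq_addr ?leqW
  ?leq_addr.
Qed.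

Definition newton_basis t i k : {poly R} := \prod_(l < k) ('X - (t (i + l)%N)%:P).

Definition newton_poly t i k : {poly R} :=
  \sum_(j < k) divdiff_sorted a b f t i j *: newton_basis t i j.

Lemma newton_basisSl t i k :
  newton_basis t i k.+1 = ('X - (t i)%:P) * newton_basis t i.+1 k.
Proof.
rewrite /newton_basis big_ord_recl addn0; congr (_ * _).
by apply: eq_bigr => l _; rewrite addSnnS.
Qed.

Lemma newton_basisSr t i k :
  newton_basis t i k.+1 = newton_basis t i k * ('X - (t (i + k)%N)%:P).
Proof. exact: big_ord_recr. Qed.

Lemma newton_basisD t i k r :
  newton_basis t i (k + r) = newton_basis t i k * newton_basis t (i + k) r.
Proof.
rewrite /newton_basis big_split_ord; congr (_ * _).
by apply: eq_bigr => l _; rewrite addnA.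
Qed.

Lemma newton_basis_cst t i k c :
  (forall l, (i <= l < i + k)%N -> t l = c) ->
  newton_basis t i k = ('X - c%:P) ^+ k.
Proof.
move=> tc; rewrite /newton_basis (eq_bigr (fun=> 'X - c%:P)) ?prodr_const ?card_ord//.
by move=> l _; rewrite tc// leq_addr ltn_add2l ltn_ord.
Qed.

Lemma newton_polySr t i k : newton_poly t i k.+1 =
  newton_poly t i k + divdiff_sorted a b f t i k *: newton_basis t i k.
Proof. exact: big_ord_recr. Qed.

Lemma size_newton_basis t i k : size (newton_basis t i k) = k.+1.
Proof.
rewrite /newton_basis (size_prod_XsubC _ (fun l : 'I_k => t (i + l)%N)).
by rewrite -[index_enum _]enumT size_enum_ord.
Qed.

Lemma newton_basis_monic t i k : newton_basis t i k \is monic.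
Proof. exact: monic_prod_XsubC. Qed.

Lemma size_newton_poly t i k : (size (newton_poly t i k) <= k)%N.
Proof.
apply: (leq_trans (size_sum _ _ _)); apply/bigmax_leqP => /= l _.
by apply: (leq_trans (size_scale_leq _ _)); rewrite size_newton_basis.
Qed.

(* Dropping the first node: the mirror image of the defining recursion, which
   drops the last one. *)
Lemma newton_polySl t i k : {homo t : l r / (l <= r)%N >-> l <= r} ->
  newton_poly t i k.+1 = newton_poly t i.+1 k
    + divdiff_sorted a b f t i k *: newton_basis t i.+1 k.
Proof.
move=> tle; elim: k => [|k IHk].
  by rewrite newton_polySr /newton_poly !big_ord0 /newton_basis !big_ord0.
rewrite newton_polySr IHk [in RHS]newton_polySr -!addrA; congr (_ + _).
rewrite [newton_basis t i k.+1]newton_basisSl.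
rewrite [newton_basis t i.+1 k.+1]newton_basisSr.
set B := newton_basis _ _ _; set d := divdiff_sorted _ _ _ _.
have dE : d i.+1 k = d i k + (t (i + k.+1)%N - t i) * d i k.+1.
  by rewrite divdiff_sortedS// addrC subrK.
rewrite dE addSnnS.
by rewrite -!mul_polyC !(polyCD, polyCB, polyCM); ring.
Qed.

Lemma newton_poly_takeP t i k r :
  exists q, newton_poly t i (k + r) = newton_poly t i k + newton_basis t i k * q.
Proof.
rewrite /newton_poly big_split_ord.
exists (\sum_(j < r) divdiff_sorted a b f t i (k + j) *: newton_basis t (i + k) j).
rewrite mulr_sumr; congr (_ + _); apply: eq_bigr => j _.
by rewrite newton_basisD scalerAr.
Qed.

Lemma newton_poly_dropP t i k r : {homo t : l r / (l <= r)%N >-> l <= r} ->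
  exists q, newton_poly t i (r + k) =
    newton_poly t (i + r) k + newton_basis t (i + r) k * q.
Proof.
move=> tle; elim: r i => [|r IHr] i; first by exists 0; rewrite mulr0 addr0 addn0.
rewrite addSn newton_polySl//.
have [q ->] := IHr i.+1; rewrite newton_basisD addSnnS.
exists (q + divdiff_sorted a b f t i (r + k) *: newton_basis t i.+1 r).
by rewrite -!mul_polyC; ring.
Qed.

Lemma newton_poly_infixP t i k n : {homo t : l r / (l <= r)%N >-> l <= r} ->
  (i + k <= n)%N ->
  exists q, newton_poly t 0 n = newton_poly t i k + newton_basis t i k * q.
Proof.
move=> tle /subnKC <-; have [q ->] := newton_poly_takeP t 0 (i + k) (n - (i + k)).
have [q' ->] := @newton_poly_dropP t 0 k i tle; rewrite newton_basisD add0n.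
by exists (q' + newton_basis t 0 i * q); ring.
Qed.

End Newton.

(** Leibniz at [c]: only the term in which all [j] derivatives fall on the power survives. *)
Lemma derivn_XsubC_exp_mul (R : comNzRingType) (c : R) (q : {poly R}) j :
  ((('X - c%:P) ^+ j * q)^`(j)).[c] = j`!%:R * q.[c].
Proof.
elim: j q => [|j IHj] q; first by rewrite derivn0 expr0 !mul1r.
rewrite derivSn derivM deriv_exp derivXsubC mul1r/=.
rewrite (_ : _ + _ =
  ('X - c%:P) ^+ j * (q *+ j.+1 + ('X - c%:P) * q^`())); last first.
  by rewrite -mulr_natr exprS; ring.
rewrite IHj !hornerE subrr mul0r addr0 hornerMn factS natrM -mulr_natl; ring.
Qed.

(** Hermite interpolation property. Modulo [('X - t i) ^+ j.+1] only the block of [j.+1] equal nodes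
    counts, and its term of degree [j] has the confluent divided difference as coefficient. *)
Lemma derivn_newton_poly (R : realType) (a b : R) (f : R -> R) (t : nat -> R) n i j :
  {homo t : l r / (l <= r)%N >-> l <= r} -> (i + j < n)%N -> t i = t (i + j)%N ->
  ((newton_poly a b f t 0 n)^`(j)).[t i] = nderive_within a b j f (t i).
Proof.
move=> tle ijn tij; have tE l : (i <= l < i + j.+1)%N -> t l = t i.
  rewrite addnS ltnS => /andP[il lk]; apply/eqP.
  by rewrite eq_le (tle _ _ il) andbT tij; exact: tle.
have [|q ->] := @newton_poly_infixP _ a b f t i j.+1 n tle; first by rewrite addnS.
rewrite newton_polySr (@newton_basis_cst _ t i j.+1 (t i))//.
rewrite (@newton_basis_cst _ t i j (t i)); last first.
  by move=> l /andP[il lj]; rewrite tE// il addnS ltnW.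
rewrite -addrA exprSr -mul_polyC mulrC -mulrA -mulrDr derivnD hornerD.
rewrite derivn_XsubC_exp_mul !hornerE subrr mul0r addr0.
rewrite [X in X.[_]]derivn_poly0 ?size_newton_poly// horner0 add0r.
rewrite divdiff_sorted_confluent// mulrC divfK// pnatr_eq0 -lt0n; exact: fact_gt0.
Qed.

(** * Rolle's theorem with multiplicities, for derivatives relative to [[a, b]] *)

Section Rolle.
Context {R : realType}.
Variables a b : R.
Implicit Types (h : R -> R) (H : nat -> R -> R) (t : nat -> R) (n : nat).

Lemma quotients_within_cvgP h x l : quotients_within a b h x --> l <->
  forall e, 0 < e -> exists2 d, 0 < d &
    forall y, y \in `[a, b] -> y != x -> `|x - y| < d ->
      `|l - (h y - h x) / (y - x)| < e.
Proof.
split=> [/cvgrPdist_lt hl e e0|hl].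
  have := hl _ e0; rewrite near_withinE near_withinE => /nbhs_ballP[d d0 dP].
  by exists d => // y yab yx xyd; apply: dP.
apply/cvgrPdist_lt => e /hl[d d0 dP]; rewrite near_withinE near_withinE.
apply/nbhs_ballP; exists d => // y xyd yx yab; exact: dP.
Qed.

Lemma quotients_within_continuous h h' x y : a <= x -> y <= b ->
  (forall z, z \in `[x, y] -> quotients_within a b h z --> h' z) ->
  {within `[x, y], continuous h}.
Proof.
move=> ax yb hh'; apply/subspace_continuousP => z /= zxy.
have /quotients_within_cvgP/(_ 1 ltr01)[d d0 dP] := hh' z zxy.
apply/cvgrPdist_lt => e e0; rewrite near_withinE.
have l0 : 0 < `|h' z| + 1 by rewrite ltr_wpDl.
(* Within [d] the difference quotient is less than 1 away from [h' z], so [|h' z| + 1] serves as a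
   local Lipschitz constant at [z]. *)
apply/nbhs_ballP; exists (Num.min d (e / (`|h' z| + 1))) => /=.
  by rewrite lt_min d0 divr_gt0.
move=> w /=; rewrite /ball/= lt_min ltr_pdivlMr// => /andP[zwd zwe] wxy.
have [->|wz] := eqVneq w z; first by rewrite subrr normr0.
have wab : w \in `[a, b] by apply: subset_itv wxy; rewrite bnd_simp.
apply: le_lt_trans zwe; have := dP _ wab wz zwd.
set q := (_ / _) => lq; have -> : h z - h w = (z - w) * q.
  by rewrite /q -(opprB w) mulNr mulrC divfK ?subr_eq0// opprB.
rewrite normrM ler_wpM2l// -[q](subrK (h' z)) (le_trans (ler_normD _ _))//.
by rewrite addrC lerD2l distrC ltW.
Qed.

Lemma quotients_within_is_derive h x l : x \in `]a, b[ ->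
  quotients_within a b h x --> l -> is_derive x 1 h l.
Proof.
rewrite in_itv/= => /andP[ax xb] /quotients_within_cvgP hl.
have hl' : e^-1 *: ((h \o shift x) (e *: 1) - h x) @[e --> 0^'] --> l.
  apply/cvgrPdist_lt => e /hl[d d0 dP]; rewrite near_withinE.
  (* The bounds [x - a] and [b - x] keep [r + x] inside [[a, b]], where the relative limit is the
     two-sided one. *)
  apply/nbhs_ballP; exists (Num.min d (Num.min (x - a) (b - x))) => /=.
    by rewrite !lt_min d0 !subr_gt0 ax xb.
  move=> r /=; rewrite /ball/= sub0r normrN !lt_min => /and3P[rd ra rb] r0.
  have -> : r^-1 *: ((h \o shift x) (r *: 1) - h x) =
      (h (r + x) - h x) / (r + x - x).
    by rewrite addrK /= [r *: 1]mulr1 [LHS]mulrC.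
  apply: dP.
  - by move: ra rb; rewrite in_itv/= !ltr_norml; lra.
  - by rewrite -subr_eq0 addrK.
  - by rewrite distrC addrK.
split; [by apply/cvg_ex; exists l | exact: cvg_lim hl'].
Qed.

Lemma Rolle_within h h' x y : a <= x -> x < y -> y <= b -> h x = h y ->
  (forall z, z \in `[x, y] -> quotients_within a b h z --> h' z) ->
  exists2 c, c \in `]x, y[ & h' c = 0.
Proof.
move=> ax xy yb hxy hh'.
have hD z : z \in `]x, y[ -> is_derive z 1 h (h' z).
  move=> zxy; apply: quotients_within_is_derive.
    by move: zxy; apply: subset_itv => /=; rewrite bnd_simp.
  by apply: hh'; apply: subset_itv_oo_cc.
have [||//|c cxy c0] := @Rolle R h x y xy.
- by move=> z /hD[].
- exact: quotients_within_continuous hh'.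
- by exists c => //; case: (hD _ cxy) => _ <-; case: c0.
Qed.

(** A chain given as a family lets iterated relative derivatives of [f] and formal derivatives of a
    polynomial be subtracted level by level. *)
Definition successive_derivatives n H := forall i x, (i < n)%N ->
  x \in `[a, b] -> quotients_within a b (H i) x --> H i.+1 x.

(* [H j] plays the role of the [j]-th derivative: a node repeated [r] times
   must be a zero of order [r]. *)
Definition vanishes_along n H t := forall i j, (i + j <= n)%N ->
  t i = t (i + j)%N -> H j (t i) = 0.

(** Induction on [n]: Rolle between consecutive nodes produces one node fewer for the shifted
    family, a repeated node being kept with its multiplicity lowered by one. *)
Lemma generalized_Rolle n H t :
  (forall i, (i < n)%N -> t i <= t i.+1) ->
  (forall i, (i <= n)%N -> t i \in `[a, b]) ->
  successive_derivatives n H -> vanishes_along n H t ->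
  exists2 x, t 0%N <= x <= t n & H n x = 0.
Proof.
elim: n H t => [|n IHn] H t tle tab dH tH.
  by exists (t 0%N); [rewrite lexx | exact: (tH 0%N 0%N)].
(* The last clause makes the new zero interior to a nondegenerate gap; it is what controls
   multiplicities below. Beyond [n] the value 0 is a dummy. *)
have /choice[s sP] : forall i, exists c, (i <= n)%N ->
    [/\ t i <= c <= t i.+1, H 1%N c = 0 &
        t i < t i.+1 -> t i < c < t i.+1].
  move=> i; have [ni|ni] := leqP i n; last by exists 0.
  have /andP[ati _] : a <= t i <= b.
    by have := tab i; rewrite in_itv/=; apply; exact: leqW.
  have /andP[_ tib] : a <= t i.+1 <= b by have := tab i.+1; rewrite in_itv/=; apply.
  have := tle i ni; rewrite le_eqVlt => /orP[/eqP tii|tii].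
    exists (t i); rewrite -tii lexx ltxx; split => //.
    by apply: tH; rewrite addn1.
  have [| |c] := @Rolle_within (H 0%N) (H 1%N) _ _ ati tii tib.
  - by rewrite (tH i 0%N) ?addn0 ?(tH i.+1 0%N) ?addn0//; exact: leqW.
  - move=> z zt; apply: dH => //.
    by apply: subset_itv zt; rewrite bnd_simp.
  rewrite in_itv/= => /andP[tc ct] c0; exists c => _.
  by rewrite c0 !ltW// tc ct.
have tmono i j : (i <= j <= n.+1)%N -> t i <= t j.
  elim: j => [|j IHj]; first by rewrite leqn0 => /andP[/eqP->].
  rewrite leq_eqVlt => /andP[/orP[/eqP->//|ij] jn].
  by rewrite (le_trans (IHj _) (tle _ _))// -ltnS ij ltnW.
have s0 : t 0%N <= s 0%N by case: (sP 0%N) => // /andP[].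
have sn : s n <= t n.+1 by case: (sP n) => // /andP[].
have [||||x /andP[sx xs] Hx] := IHn (fun i => H i.+1) s.
- move=> i ni; case: (sP i (ltnW ni)) => /andP[_ si] _ _.
  by case: (sP i.+1 ni) => /andP[si' _] _ _; exact: le_trans si'.
- move=> i ni; case: (sP i ni) => /andP[ti it] _ _; rewrite in_itv/=.
  have := tab i; have := tab i.+1; rewrite !in_itv/= ltnS ni (leqW ni).
  move=> /(_ isT)/andP[_ tb] /(_ isT)/andP[ta _].
  by rewrite (le_trans ta ti) (le_trans it tb).
- by move=> i x ni xab; exact: dH.
- move=> i [|j] ijn sij.
    by case: (sP i); first by rewrite addn0 in ijn.
  have ni : (i <= n)%N by rewrite (leq_trans _ ijn)// leq_addr.
  have [/andP[ti si] _ si'] := sP i ni.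
  have [/andP[tj sj] _ sj'] := sP _ ijn.
  have tij : t i.+1 <= t (i + j.+1)%N.
    by rewrite tmono// leqW// andbT addnS ltnS leq_addr.
  (* If new zeros coincide, a nondegenerate gap at either end would separate them strictly. Hence
     the old nodes from [i] to [i + j.+2] all coincide, one more than the new ones. *)
  have E1 : t i = t i.+1.
    apply/eqP; rewrite eq_le tle//= leNgt; apply/negP => /si'/andP[_].
    by rewrite ltNge sij (le_trans tij).
  have E2 : t (i + j.+1)%N = t (i + j.+1).+1.
    apply/eqP; rewrite eq_le tle//= leNgt; apply/negP => /sj'/andP[+ _].
    by rewrite ltNge -sij (le_trans si).
  have sti : s i = t i by apply/eqP; rewrite eq_le ti andbT [leRHS]E1.
  have stj : s (i + j.+1)%N = t (i + j.+1)%N.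
    by apply/eqP; rewrite eq_le tj andbT [leRHS]E2.
  by rewrite sti; apply: tH; rewrite addnS ?ltnS// -E2 -stj -sij sti.
by exists x => //; rewrite (le_trans s0 sx) (le_trans xs).
Qed.

Lemma successive_derivativesB n H H' : successive_derivatives n H ->
  successive_derivatives n H' ->
  successive_derivatives n (fun i x => H i x - H' i x).
Proof.
move=> dH dH' i x ni xab.
rewrite /quotients_within (_ : (fun y => _) = fun y =>
    (H i y - H i x) / (y - x) - (H' i y - H' i x) / (y - x)).
  exact: cvgB (dH _ _ ni xab) (dH' _ _ ni xab).
by apply/funext => y; rewrite -mulrBl; congr (_ / _); ring.
Qed.

(** The difference quotient of [q] at [x] is the value of the cofactor of ['X - x] in [q - q.[x]],
    and this cofactor is continuous. *)
Lemma successive_derivatives_poly n (p : {poly R}) :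
  successive_derivatives n (fun i => horner p^`(i)).
Proof.
move=> i x _ xab; rewrite derivnS; set q := p^`(i).
have /factor_theorem[r rE] : root (q - q.[x]%:P) x.
  by rewrite /root hornerD hornerN hornerC subrr.
have qE : q = r * ('X - x%:P) + q.[x]%:P by rewrite -rE subrK.
have -> : q^`().[x] = r.[x].
  rewrite qE derivD derivM derivXsubC derivC mulr1 addr0.
  by rewrite hornerD hornerM hornerXsubC subrr mulr0 add0r.
apply: (quotients_within_cvgP (horner q) x r.[x]).2 => e e0.
have /cvgrPdist_lt/(_ e e0)/nbhs_ballP[d d0 dP] := @continuous_horner R r x.
exists d => // y _ yx xyd.
have -> : (q.[y] - q.[x]) / (y - x) = r.[y].
  by rewrite [in q.[y]]qE hornerD hornerC addrK hornerM hornerXsubC mulfK// subr_eq0.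
exact: dP.
Qed.

End Rolle.

(** * Polynomial derivatives and mean values of Hermite interpolants *)

Lemma derivn_lead_coef (R : nzRingType) (p : {poly R}) n :
  (size p <= n.+1)%N -> p^`(n) = (p`_n *+ n`!)%:P.
Proof.
move=> pn; apply/polyP => i; rewrite coef_derivn coefC.
case: i => [|i] /=; first by rewrite addn0 ffactnn.
by rewrite nth_default ?mul0rn// (leq_trans pn)// addnS ltnS leq_addr.
Qed.

Lemma derivn_XsubC_exp_mul0 (R : comNzRingType) (c : R) (q : {poly R}) j k :
  (j < k)%N -> ((('X - c%:P) ^+ k * q)^`(j)).[c] = 0.
Proof.
move=> jk; rewrite -(subnKC (ltnW jk)) exprD -mulrA derivn_XsubC_exp_mul.
have [r ->] : exists r, (k - j)%N = r.+1 by exists (k - j.+1)%N; rewrite -subSn.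
by rewrite exprS -mulrA hornerM hornerXsubC subrr mul0r mulr0.
Qed.

Section MeanValue.
Context {R : realType}.
Variables (a b : R) (n : nat) (f : R -> R).
Hypothesis hf : Cn_within a b n f.

Lemma Cn_within_successive :
  successive_derivatives a b n (fun k => nderive_within a b k f).
Proof. by move=> i x ni xab; exact: hf.1. Qed.

(** Generalized Rolle applied to [f - p]; the [n]-th derivative of [p] is constant by the size
    bound. *)
Lemma Hermite_interpolant_mean_value (t : nat -> R) (p : {poly R}) :
  {homo t : l r / (l <= r)%N >-> l <= r} ->
  (forall i, (i <= n)%N -> t i \in `[a, b]) ->
  (size p <= n.+1)%N ->
  (forall i j, (i + j <= n)%N -> t i = t (i + j)%N ->
     (p^`(j)).[t i] = nderive_within a b j f (t i)) ->
  exists2 x, t 0%N <= x <= t n & nderive_within a b n f x = p`_n *+ n`!.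
Proof.
move=> tle tab pn pf.
have [| |x xt] := generalized_Rolle (n := n) _ tab
  (successive_derivativesB Cn_within_successive
    (@successive_derivatives_poly _ a b n p)).
- by move=> i _; exact: tle.
- by move=> i j ijn tij; rewrite pf// subrr.
by rewrite derivn_lead_coef// hornerC => /subr0_eq; exists x.
Qed.

Lemma divdiff_sorted_mean_value (t : nat -> R) :
  {homo t : l r / (l <= r)%N >-> l <= r} ->
  (forall i, (i <= n)%N -> t i \in `[a, b]) ->
  exists2 x, t 0%N <= x <= t n &
    nderive_within a b n f x = divdiff_sorted a b f t 0 n *+ n`!.
Proof.
move=> tle tab.
have [|x xt xE] :=
    Hermite_interpolant_mean_value tle tab (size_newton_poly a b f t 0 n.+1).
  by move=> i j ijn tij; rewrite derivn_newton_poly.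
exists x => //; rewrite xE newton_polySr coefD coefZ.
rewrite nth_default ?size_newton_poly// add0r.
have /monicP := newton_basis_monic t 0 n.
by rewrite lead_coefE size_newton_basis => ->; rewrite mulr1.
Qed.

(** A negative value would persist near [x] by continuity, but nodes clustered there give a nearby
    mean value of the right sign. The scalar [s] covers convexity and concavity at once. *)
Lemma nderive_within_sign (s : R) :
  a < b ->
  (forall t : nat -> R, {homo t : l r / (l < r)%N >-> l < r} ->
     (forall i, (i <= n)%N -> t i \in `[a, b]) ->
     0 <= s * divdiff_sorted a b f t 0 n) ->
  forall x, x \in `[a, b] -> 0 <= s * nderive_within a b n f x.
Proof.
move=> ab fs x xab; rewrite leNgt; apply/negP => sx.
have /subspace_continuousP/(_ x xab)/cvgrPdist_lt := hf.2.
move: sx; set F := nderive_within a b n f => sx.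
have s0 : s != 0 by apply: contraTneq sx => ->; rewrite mul0r ltxx.
have e0 : 0 < `|F x|.
  by rewrite normr_gt0; apply: contraTneq sx => ->; rewrite mulr0 ltxx.
move=> /(_ _ e0); rewrite near_withinE => /nbhs_ballP[d d0 dP].
(* The tolerance is [|F x|]: any value closer than that to [F x] has the sign of [F x]. *)
have sF y : y \in `[a, b] -> `|x - y| < d -> s * F y < 0.
  move=> yab xyd; have /(_ yab) := dP y xyd.
  rewrite -(@ltr_pM2l _ `|s|) ?normr_gt0// -!normrM (ltr0_norm sx) mulrBr.
  by rewrite ltr_norml => /andP[+ _]; rewrite opprK ltrDl oppr_gt0.
have d2 : d / 2 < d :> R by rewrite ltr_pdivrMr// ltr_pMr// ltr1n.
have d20 : 0 < d / 2 :> R by rewrite divr_gt0.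
(* The small interval lies to the right of [x], except at [x = b], where it lies to the left. *)
have [c [e [ac ce eb cx xe]]] : exists c e,
    [/\ a <= c, c < e, e <= b, x - d < c & e < x + d].
  move: xab; rewrite in_itv/= => /andP[ax xb].
  have [xb'|bx] := ltP x b.
    exists x, (Num.min b (x + d / 2)); split => //.
    - by rewrite lt_min xb' ltrDl.
    - by rewrite ge_min lexx.
    - by rewrite ltrBlDr ltrDl.
    - rewrite gt_min; apply/orP; right; rewrite ltrD2l; exact: d2.
  exists (Num.max a (x - d / 2)), x; split => //.
  - by rewrite le_max lexx.
  - by rewrite gt_max (lt_le_trans ab bx) gtrDl oppr_lt0.
  - by rewrite lt_max; apply/orP; right; rewrite ltrD2l ltrN2.
  - by rewrite ltrDl.
(* Equally spaced nodes; the denominator [n.+1] is nonzero even for [n = 0]. *)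
pose t i := c + (e - c) * (i%:R / n.+1%:R).
have tlt : {homo t : l r / (l < r)%N >-> l < r}.
  move=> l r lr; rewrite ltrD2l ltr_pM2l ?subr_gt0// ltr_pM2r ?invr_gt0//.
  by rewrite ltr_nat.
have tle : {homo t : l r / (l <= r)%N >-> l <= r}.
  by move=> l r; rewrite leq_eqVlt => /orP[/eqP->//|/tlt/ltW].
have tce i : (i <= n)%N -> c <= t i <= e.
  move=> ni; rewrite lerDl mulr_ge0 ?divr_ge0 ?subr_ge0 ?(ltW ce)//=.
  rewrite -lerBrDl ler_piMr ?subr_ge0 ?(ltW ce)// ler_pdivrMr// mul1r ler_nat.
  exact: leqW.
have tab i : (i <= n)%N -> t i \in `[a, b].
  by move=> /tce/andP[ct te]; rewrite in_itv/= (le_trans ac ct) (le_trans te eb).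
have [z /andP[tz zt] zE] := divdiff_sorted_mean_value tle tab.
have /andP[cz _] := tce 0%N isT; have /andP[_ ze] := tce n (leqnn n).
have cz' := le_trans cz tz; have ze' := le_trans zt ze.
have : s * F z < 0.
  apply: sF; first by rewrite in_itv/= (le_trans ac cz') (le_trans ze' eb).
  by rewrite ltr_norml; lra.
by rewrite /F zE mulrnAr ltNge mulrn_wge0// fs.
Qed.

End MeanValue.

(** * From lists of points to increasing node sequences *)

Section NConvex.
Context {R : realType}.
Variables (a b : R) (n : nat).
Implicit Types (f : R -> R) (t : nat -> R).

Lemma divdiff_nodes f t s :
  {homo t : l r / (l <= r)%N >-> l <= r} -> s = map t (iota 0 (size s)) ->
  (0 < size s)%N ->
  divdiff a b f s = divdiff_sorted a b f t 0 (size s).-1.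
Proof.
move=> tle st s0; rewrite /divdiff; apply: eq_divdiff_sorted => l /= ls.
rewrite sort_le_id; last first.
  rewrite st sorted_map; apply: (sub_sorted _ (iota_sorted _ _)) => i j /=.
  exact: tle.
by rewrite st (nth_map 0%N) ?size_iota ?nth_iota// -(prednK s0) ltnS.
Qed.

Lemma nconvex_divdiff_sorted f t : nconvex a b n f ->
  {homo t : l r / (l < r)%N >-> l < r} ->
  (forall i, (i <= n)%N -> t i \in `[a, b]) ->
  0 <= divdiff_sorted a b f t 0 n.
Proof.
move=> fn tlt tab.
have tle : {homo t : l r / (l <= r)%N >-> l <= r}.
  by move=> l r; rewrite leq_eqVlt => /orP[/eqP->//|/tlt/ltW].
have tinj : injective t.
  by move=> i j tij; case: (ltngtP i j) => // /tlt; rewrite tij ltxx.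
have ts : size (map t (iota 0 n.+1)) == n.+1 by rewrite size_map size_iota.
have tu : uniq (map t (iota 0 n.+1)) by rewrite map_inj_uniq// iota_uniq.
have tin : {in map t (iota 0 n.+1), forall x, x \in `[a, b]}.
  by move=> x /mapP[i]; rewrite mem_iota => /= i_n ->; exact: tab.
have := fn (Tuple ts) tu tin.
by rewrite (divdiff_nodes f tle) ?(eqP ts).
Qed.

(** Strictly increasing nodes keep the recursion out of its derivative branch, so negation passes
    through algebraically. *)
Lemma divdiff_sortedN f t i k : {homo t : l r / (l < r)%N >-> l < r} ->
  divdiff_sorted a b (fun x => - f x) t i k = - divdiff_sorted a b f t i k.
Proof.
move=> tlt; elim: k i => [//|k IHk] i /=.
have /lt_eqF-> : t i < t (i + k.+1)%N by apply: tlt; rewrite addnS ltnS leq_addr.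
by rewrite !IHk -mulNr; congr (_ / _); ring.
Qed.

End NConvex.

(** * Interpolation remainder for two multiple nodes *)

Section TwoPointRemainder.
Context {R : realType}.
Variables (a b : R).

Definition two_nodes m l := if (l < m)%N then a else b.

Lemma two_nodes_le m : a <= b ->
  {homo two_nodes m : l r / (l <= r)%N >-> l <= r}.
Proof.
move=> ab l r lr; rewrite /two_nodes; case: (ltnP r m) => rm.
  by rewrite (leq_ltn_trans lr rm).
by case: ifP.
Qed.

Lemma newton_basis_two_nodes m k :
  newton_basis (two_nodes m) 0 (m + k) = ('X - a%:P) ^+ m * ('X - b%:P) ^+ k.
Proof.
rewrite newton_basisD (@newton_basis_cst _ _ _ _ a).
  rewrite (@newton_basis_cst _ _ _ _ b)// => l /andP[ml _].
  by rewrite /two_nodes ltnNge ml.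
by move=> l; rewrite /two_nodes add0n => /= ->.
Qed.

(** For interior [x], a multiple of the nodal polynomial [B] is added to [N] so as to match [f] at
    [x] too; the mean value lemma on these [n.+1] nodes identifies the multiple. *)
Lemma newton_poly_two_nodes_remainder n m f x : a < b -> (0 < m < n)%N ->
  Cn_within a b n f -> x \in `[a, b] -> exists2 z, z \in `[a, b] &
    f x - (newton_poly a b f (two_nodes m) 0 n).[x] =
    nderive_within a b n f z / n`!%:R * ((x - a) ^+ m * (x - b) ^+ (n - m)).
Proof.
move=> ab /andP[m0 mn] hf; rewrite in_itv/= => /andP[ax xb].
set N := newton_poly _ _ _ _ _ _.
have ule := two_nodes_le m (ltW ab).
have uab l : two_nodes m l \in `[a, b].
  by rewrite /two_nodes in_itv/=; case: ifP; rewrite lexx ltW.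
have Na j : (j < m)%N -> (N^`(j)).[a] = nderive_within a b j f a.
  move=> jm; have := @derivn_newton_poly R a b f (two_nodes m) n 0 j ule.
  by rewrite add0n (ltn_trans jm mn) /two_nodes m0 jm; apply.
have Nb j : (j < n - m)%N -> (N^`(j)).[b] = nderive_within a b j f b.
  move=> jm; have := @derivn_newton_poly R a b f (two_nodes m) n m j ule.
  by rewrite -ltn_subRL jm /two_nodes ltnn ltnNge leq_addr; apply.
(* At an endpoint both sides vanish, so any point of [[a, b]] can serve as [z]. *)
have [<-|xa] := eqVneq a x.
  exists a; first by rewrite in_itv/= lexx ltW.
  by rewrite -[N]derivn0 Na//= !subrr expr0n -[m == 0%N]negbK -lt0n m0 mul0r mulr0.
have [->|xb'] := eqVneq x b.
  exists b; first by rewrite in_itv/= lexx ltW.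
  rewrite -[N]derivn0 Nb ?subn_gt0//= !subrr expr0n.
  by rewrite -[(n - m)%N == 0%N]negbK -lt0n subn_gt0 mn !mulr0.
have {ax}ax : a < x by rewrite lt_neqAle xa.
have {xb xb'}xb : x < b by rewrite lt_neqAle xb'.
set B : {poly R} := newton_basis (two_nodes m) 0 n.
have BE : B = ('X - a%:P) ^+ m * ('X - b%:P) ^+ (n - m).
  by rewrite /B -{1}(subnKC (ltnW mn)) newton_basis_two_nodes.
have Bx : B.[x] = (x - a) ^+ m * (x - b) ^+ (n - m).
  by rewrite BE hornerM !horner_exp !hornerXsubC.
have Bx0 : B.[x] != 0.
  by rewrite Bx mulf_neq0// expf_neq0// subr_eq0 ?(gt_eqF ax)// (lt_eqF xb).
pose c := (f x - N.[x]) / B.[x].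
(* Up to index [n]: [m] copies of [a], then [x] once, then [n - m] copies of [b]. *)
pose t l := if (l < m)%N then a else if l == m then x else b.
have tle : {homo t : l r / (l <= r)%N >-> l <= r}.
  move=> l r lr; rewrite /t; have [lm|lm] := ltnP l m.
    by case: ifP => // _; case: ifP => _; rewrite ltW// (lt_trans ax).
  rewrite ltnNge (leq_trans lm lr)/=; case: (eqVneq l m) => [_|lm'].
    by case: ifP => // _; exact: ltW.
  by rewrite gtn_eqF// (leq_trans _ lr)// ltn_neqAle eq_sym lm'.
have tab l : (l <= n)%N -> t l \in `[a, b].
  rewrite /t in_itv/= => _; case: ifP => _; first by rewrite lexx ltW.
  by case: ifP => _; rewrite ?lexx !ltW// (lt_trans ax).
have [|i j ijn|z] :=
  @Hermite_interpolant_mean_value R a b n f hf t (N + c *: B) tle tab.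
- rewrite (leq_trans (size_polyD _ _))// geq_max.
  rewrite (leq_trans (size_newton_poly _ _ _ _ _ _))//=.
  by rewrite (leq_trans (size_scale_leq _ _))// size_newton_basis.
- rewrite derivnD derivnZ hornerD hornerZ /t.
  (* A block of equal nodes lies wholly at [a], at [x] (only with [j = 0]), or at [b]; at [a] and
     [b] the term in [B] vanishes to high enough order. *)
  have [ijm|mij] := ltnP (i + j) m.
    have im : (i < m)%N by rewrite (leq_ltn_trans (leq_addr j i)).
    have jm : (j < m)%N by rewrite (leq_ltn_trans (leq_addl i j)).
    by rewrite im Na// BE derivn_XsubC_exp_mul0// mulr0 addr0.
  have [im|mi] := ltnP i m.
    by case: ifP => _ /eqP; rewrite lt_eqF// (lt_trans ax).
  have [->|im] := eqVneq i m.
    case: j {mij} ijn => [|j] ijn; last first.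
      by rewrite gtn_eqF ?addnS ?ltnS ?leq_addr// => /eqP; rewrite lt_eqF.
    by move=> _; rewrite !derivn0 /c divfK// addrC subrK.
  have {im mi}im : (m < i)%N by rewrite ltn_neqAle eq_sym im.
  have jnm : (j < n - m)%N.
    by rewrite ltn_subRL (leq_trans _ ijn)// ltn_add2r.
  by rewrite Nb// BE [('X - a%:P) ^+ m * _]mulrC derivn_XsubC_exp_mul0// mulr0 addr0.
move=> /andP[tz zt] zE; exists z.
  have := tab n (leqnn n); have := tab 0%N isT; rewrite !in_itv/=.
  by move=> /andP[at0 _] /andP[_ tb]; rewrite (le_trans at0 tz) (le_trans zt tb).
rewrite zE coefD coefZ nth_default ?size_newton_poly// add0r.
have /monicP := newton_basis_monic (two_nodes m) 0 n.
rewrite lead_coefE size_newton_basis -/B => ->.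
rewrite mulr1 -[c *+ _]mulr_natr mulfK ?pnatr_eq0 -?lt0n ?fact_gt0//.
by rewrite -Bx divfK.
Qed.

End TwoPointRemainder.

(** * Linear combinations under the functional *)

Section PositiveFunctional.
Context {R : realType} {E : Type}.
Variables (L : {pred E -> R}) (A : (E -> R) -> R).
Hypotheses (hL : submod_closed L) (hA : normalized_positive_functional L A).

Lemma submod_closed_lincomb n (c : nat -> R) (h : nat -> E -> R) :
  (forall j, (j < n)%N -> h j \in L) -> \sum_(0 <= j < n) c j *: h j \in L.
Proof.
elim: n => [|n IHn] hL'; first by rewrite big_nil; exact: hL.1.
rewrite big_nat_recr//= addrC; apply: hL.2; first exact: hL'.
by apply: IHn => j jn; apply: hL'; exact: ltnW.
Qed.

Lemma functional0 : A 0 = 0.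
Proof.
(* The coefficient -1 turns linearity into [A 0 = - A 0 + A 0]. *)
have [Alin _ _] := hA; have := Alin 0 0 hL.1 hL.1 (-1).
by rewrite scaler0 add0r mulN1r addNr.
Qed.

Lemma functionalZ c : {in L, forall h, A (c *: h) = c * A h}.
Proof.
have [Alin _ _] := hA => h hL'; rewrite -[c *: h]addr0 Alin ?hL.1//.
by rewrite functional0 addr0.
Qed.

Lemma functional_lincomb n (c : nat -> R) (h : nat -> E -> R) :
  (forall j, (j < n)%N -> h j \in L) ->
  A (\sum_(0 <= j < n) c j *: h j) = \sum_(0 <= j < n) c j * A (h j).
Proof.
have [Alin _ _] := hA.
elim: n => [|n IHn] hL'; first by rewrite !big_nil functional0.
have hL'' j : (j < n)%N -> h j \in L by move=> jn; apply: hL'; exact: ltnW.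
rewrite !big_nat_recr//= addrC Alin ?hL' ?submod_closed_lincomb//.
by rewrite IHn// addrC.
Qed.

End PositiveFunctional.

(** * The two-node Newton form composed with [g] *)

Section TwoPointFunctional.
Context {R : realType} {E : Type}.
Variables (a b : R) (g : E -> R).

Lemma map_two_nodes m k :
  nseq m a ++ nseq k b = map (two_nodes a b m) (iota 0 (m + k)).
Proof.
have /all_pred1P/esym : all (pred1 a) (map (two_nodes a b m) (iota 0 m)).
  apply/allP => x /mapP[l]; rewrite mem_iota => /= lm ->.
  by rewrite /two_nodes lm /=.
have /all_pred1P/esym : all (pred1 b) (map (two_nodes a b m) (iota m k)).
  apply/allP => x /mapP[l]; rewrite mem_iota => /andP[ml _] ->.
  by rewrite /two_nodes ltnNge ml /=.
by rewrite !size_map !size_iota iotaD map_cat => -> ->.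
Qed.

(** The Newton basis composed with [g], in the two shapes that occur as arguments of [A] in the
    final sums. *)
Definition two_nodes_power m j : E -> R :=
  if (j < m)%N then (g - cst a) ^+ j
  else (g - cst a) ^+ m * (g - cst b) ^+ (j - m).

Lemma newton_basis_two_nodes_comp m j x :
  (newton_basis (two_nodes a b m) 0 j).[g x] = two_nodes_power m j x.
Proof.
rewrite /two_nodes_power; have [jm|mj] := ltnP j m.
  rewrite (@newton_basis_cst _ _ _ _ a) => [|l /= lj].
    by rewrite horner_exp hornerXsubC exprfctE.
  by rewrite /two_nodes (ltn_trans _ jm).
rewrite -{1}(subnKC mj) newton_basis_two_nodes hornerM !horner_exp !hornerXsubC.
by rewrite -[RHS]/(((g - cst a) ^+ m) x * ((g - cst b) ^+ (j - m)) x) !exprfctE.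
Qed.

Lemma newton_poly_two_nodes_comp f m n :
  (fun x => (newton_poly a b f (two_nodes a b m) 0 n).[g x]) =
  \sum_(0 <= j < n)
    divdiff_sorted a b f (two_nodes a b m) 0 j *: two_nodes_power m j.
Proof.
elim: n => [|n IHn].
  by apply/funext => x; rewrite big_nil /newton_poly big_ord0 horner0.
apply/funext => x; rewrite big_nat_recr//= -IHn newton_polySr hornerD hornerZ.
by rewrite newton_basis_two_nodes_comp.
Qed.

End TwoPointFunctional.

(** * The inequalities for [LR] *)

Theorem theorem2p1 (R : realType) (E : Type) (hE : inhabited E)
    (L : {pred E -> R}) (hL : submod_closed L) (hL1 : 1 \in L)
    (A : (E -> R) -> R) (hA : normalized_positive_functional L A)
    (a b : R) (hab : a < b) (n m : nat) (hm : (3 <= m)%N) (hmn : (m <= n - 1)%N)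
    (f : R -> R) (hf : Cn_within a b n f)
    (g : E -> R) (hg : g \in L) (hgab : forall t, g t \in `[a, b])
    (hfg : f \o g \in L)
    (* the arguments of A in the sums below lie in its domain *)
    (hpowa : forall k, (2 <= k <= m - 1)%N -> (g - cst a) ^+ k \in L)
    (hpowab : forall k, (1 <= k <= n - m)%N ->
       (g - cst a) ^+ m * (g - cst b) ^+ (k - 1) \in L) :
  let RHS :=
    (A g - a) * (divdiff a b f [:: a; a] - divdiff a b f [:: a; b])
    + \sum_(2 <= k < m)
        nderive_within a b k f a / k`!%:R * A ((g - cst a) ^+ k)
    + \sum_(1 <= k < (n - m).+1)
        divdiff a b f (nseq m a ++ nseq k b)
        * A ((g - cst a) ^+ m * (g - cst b) ^+ (k - 1)) in
  ((nconvex a b n f /\ odd n <> odd m) \/ (nconcave a b n f /\ odd n = odd m) ->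
     LR f g a b A <= RHS) /\
  ((nconvex a b n f /\ odd n = odd m) \/ (nconcave a b n f /\ odd n <> odd m) ->
     LR f g a b A >= RHS).
Proof.
move=> rhs; have [Alin Apos A1] := hA.
have mn : (m < n)%N by lia.
have m0 : (0 < m)%N by lia.
pose u := two_nodes a b m; pose D := divdiff_sorted a b f u 0.
have ule := two_nodes_le m (ltW hab); pose B := two_nodes_power a b g m.
have ga1 : g - cst a = (- a) *: (1 : E -> R) + g.
  apply/funext => x; rewrite -[RHS]/(- a * 1 + g x) mulr1 [RHS]addrC.
  by rewrite -[LHS]/(g x - a).
have Aga : A (g - cst a) = A g - a.
  by rewrite ga1 Alin// A1 mulr1 [RHS]addrC.
have BL j : (j < n)%N -> B j \in L.
  rewrite /B /two_nodes_power => jn; have [jm|mj] := ltnP j m.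
    case: j jn jm => [|[|j]] jn jm; [by rewrite expr0 | | by apply: hpowa; lia].
    by rewrite expr1 ga1; exact: hL.2.
  have -> : (j - m = (j - m).+1 - 1)%N by rewrite subn1.
  by apply: hpowab; lia.
have Nsum := newton_poly_two_nodes_comp a b g f m n.
set N := newton_poly _ _ _ _ _ _ in Nsum.
pose Ng : E -> R := fun x => N.[g x].
have NL : Ng \in L by rewrite /Ng Nsum; exact: submod_closed_lincomb.
(* The terms of index 0 and 1 of [A Ng] are [f a] and [f[a,a] * (A g - a)]; with the chord in [LR]
   they account for the first summand of [rhs]. *)
have LRE : LR f g a b A - rhs = A (-1 *: Ng + (f \o g)).
  rewrite Alin// /Ng Nsum (functional_lincomb hL hA)//.
  rewrite (big_cat_nat (leq0n m) (ltnW mn))/=.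
  rewrite big_ltn// big_ltn ?(leq_trans _ hm)//.
  have Da k : (k < m)%N -> D k = nderive_within a b k f a / k`!%:R.
    by move=> km; rewrite /D divdiff_sorted_confluent /u /two_nodes ?add0n ?m0 ?km.
  have DaB k : (k < m)%N ->
      D k * A (B k) = nderive_within a b k f a / k`!%:R * A ((g - cst a) ^+ k).
    by move=> km; rewrite Da// /B /two_nodes_power km.
  rewrite (DaB 0%N m0) (DaB 1%N (leq_trans _ hm))//.
  under eq_big_nat => k /andP[_ km] do rewrite DaB//.
  (* Order [k] means [k.+1] nodes, so for [k >= m] there are [k - m + 1] copies of [b]: hence the
     shifted index and the exponent [k - 1]. *)
  have -> : \sum_(m <= k < n) D k * A (B k) = \sum_(1 <= k < (n - m).+1)
        divdiff a b f (nseq m a ++ nseq k b)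
        * A ((g - cst a) ^+ m * (g - cst b) ^+ (k - 1)).
    rewrite big_add1 succnK -[X in \sum_(X <= _ < n) _]add0n big_addn.
    apply: eq_big_nat => k _; rewrite subn1 succnK.
    have -> : B (k + m)%N = (g - cst a) ^+ m * (g - cst b) ^+ k.
      by rewrite /B /two_nodes_power ltnNge leq_addl addnK.
    congr (_ * _).
    have sE : size (nseq m a ++ nseq k.+1 b) = (k + m).+1.
      by rewrite size_cat !size_nseq addnS addnC.
    rewrite (divdiff_nodes a b f ule); rewrite ?sE//.
    by rewrite map_two_nodes addnS addnC.
  rewrite /rhs /LR.
  have -> : divdiff a b f [:: a; a] = nderive_within a b 1 f a / 1`!%:R.
    by rewrite (@divdiff_nodes _ a b f (fun=> a))//= eqxx.
  have -> : divdiff a b f [:: a; b] = (f b - f a) / (b - a).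
    rewrite (@divdiff_nodes _ a b f (two_nodes a b 1)) ?lt_eqF//.
      by rewrite /= /two_nodes/= lt_eqF.
    by apply: two_nodes_le; exact: ltW.
  rewrite expr0 A1 expr1 Aga /=.
  have ba : b - a != 0 by rewrite subr_eq0 gt_eqF.
  by rewrite !divr1 mulr1;
    move: (\sum_(2 <= k < m) _) (\sum_(1 <= k < _) _) => S1 S2; field.
have hL' : -1 *: Ng + (f \o g) \in L by exact: hL.2.
(* By positivity of [A] it suffices to find the sign of the remainder pointwise. *)
have key (s : R) :
    (forall t : nat -> R, {homo t : l r / (l < r)%N >-> l < r} ->
       (forall i, (i <= n)%N -> t i \in `[a, b]) ->
       0 <= s * divdiff_sorted a b f t 0 n) ->
    0 <= s * (-1) ^+ (n - m) * (LR f g a b A - rhs).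
  move=> fs; have F0 := nderive_within_sign hf hab fs.
  rewrite LRE -(functionalZ hL hA)//; apply: Apos.
    by rewrite -[_ *: _]addr0; apply: hL.2 => //; exact: hL.1.
  move=> x; rewrite -[leRHS]/(_ * (-1 * N.[g x] + f (g x))) mulN1r addrC.
  have m0n : (0 < m < n)%N by rewrite m0.
  have [z zab ->] := newton_poly_two_nodes_remainder hab m0n hf (hgab x).
  have := hgab x; rewrite in_itv/= => /andP[ax xb].
  (* The sign is absorbed by turning [g x - b] into the nonnegative [b - g x]. *)
  have -> : s * (-1) ^+ (n - m) * (nderive_within a b n f z / n`!%:R *
      ((g x - a) ^+ m * (g x - b) ^+ (n - m))) =
    s * nderive_within a b n f z * (n`!%:R^-1 *
      ((g x - a) ^+ m * (b - g x) ^+ (n - m))).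
    have -> : (b - g x) ^+ (n - m) = (-1) ^+ (n - m) * (g x - b) ^+ (n - m).
      by rewrite -exprMn mulN1r opprB.
    ring.
  by rewrite mulr_ge0 ?F0// mulr_ge0 ?invr_ge0// mulr_ge0 ?exprn_ge0 ?subr_ge0.
have sgn : (-1) ^+ (n - m) = (-1) ^+ (odd n != odd m) :> R.
  by rewrite -signr_odd oddB ?(ltnW mn)// negb_eqb.
(* The boolean selects convexity or concavity; its sign times the parity sign fixes the direction of
   the inequality. *)
have fP s : (if s then nconvex a b n f else nconcave a b n f) ->
    0 <= (-1) ^+ (~~ s) * (-1) ^+ (n - m) * (LR f g a b A - rhs).
  move=> fs; apply: key => t tlt tab; case: s fs => fs.
    by rewrite expr0 mul1r nconvex_divdiff_sorted.
  by rewrite expr1 mulN1r -divdiff_sortedN// nconvex_divdiff_sorted.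
move: (fP true) (fP false); rewrite sgn; move: (LR f g a b A) => lr.
case: eqP => odd_nm;
  rewrite ?(expr0, expr1, mulN1r, mul1r, opprK, opprB) !subr_ge0; tauto.
Qed.
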